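(* Let $0<|q|<1$ and fix a square root $q^{1/2}$ of $q$ (with $q^{x}$ for half-integers $x$ defined as the corresponding integer power of $q^{1/2}$). Then \[ \sum_{i,j\geq0}\frac{(-1)^{i+j}q^{(i-j)^{2}/2}(q^{j}-q^{i+1/2})}{(q;q)_{i}(q;q)_{j}} =\frac{(q^{1/2};q)_{\infty}^{2}}{(q;q)_{\infty}}, \] and \[ \sum_{i,j\geq0}\frac{q^{(i-j)^{2}/2}(q^{j}+q^{i+1/2})}{(q;q)_{i}(q;q)_{j}} =\frac{(q;q^{2})_{\infty}}{(q^{2};q^{2})_{\infty}(q^{1/2};q)_{\infty}^{2}}. \]
   Context: For $a\in\mathbb{C}$ and $|p|<1$: $(a;p)_0=1$, $(a;p)_n=\prod_{k=0}^{n-1}(1-ap^k)$, $(a;p)_\infty=\prod_{k\ge0}(1-ap^k)$. *)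

(* Defs.v *)
From mathcomp Require Import all_boot all_order all_algebra.
From mathcomp Require Import all_classical all_reals all_analysis.
From mathcomp Require Import summability.
From mathcomp Require Export complex.

Set Implicit Arguments.
Unset Strict Implicit.
Unset Printing Implicit Defensive.

Import Order.TTheory GRing.Theory Num.Theory.
Import numFieldNormedType.Exports.

Local Open Scope classical_set_scope.
Local Open Scope ring_scope.

Definition qpoch (K : numFieldType) (a p : K) (n : nat) : K :=
  \prod_(0 <= k < n) (1 - a * p ^+ k).

(* The partial products converge when `|p| < 1; the value of [lim] is
   meaningless otherwise. *)
Definition qpoch_infty (K : numFieldType) (a p : K) : K :=
  lim (qpoch a p n @[n --> \oo]).

(* Unconditional convergence: the sums over finite sets of index pairs converge
   to l along the directed set of finite subsets of nat * nat. Over the complex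
   numbers this is the same as absolute convergence with sum l. *)
Definition has_double_sum (K : numFieldType) (u : nat -> nat -> K) (l : K) :=
  partial_sum (fun ij : nat * nat => u ij.1 ij.2) @ totally --> l.

(* Main.v *)
(** Both identities are one identity, read at [-s] and at [s]:
    sum_(i,j) s^((i-j)^2) (q^j + s^(2i+1)) / ((q;q)_i (q;q)_j)
      = (-s;q)_oo^2 / (q;q)_oo.
    Since s^(2i+1) = s q^i, the summand is v_(ij) + s v_(ji) with
    v_(ij) = s^((i-j)^2) q^j / ((q;q)_i (q;q)_j), and |v_(ij)| is at most a
    constant times |s|^(i+j) because |i-j| + 2j >= i + j.  Summing v first over i
    is an instance of Euler's expansion of (x;q)_oo and gives
    (-s;q)_oo (-s;q)_j q^j / (q;q)_j; the sum over j then telescopes, so that v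
    sums to (-s;q)_oo^2 / ((1+s) (q;q)_oo).  The second right-hand side is
    (-s;q)_oo^2 / (q;q)_oo rewritten with (-s;q)_oo (s;q)_oo = (q;q^2)_oo and
    (q;q)_oo = (q;q^2)_oo (q^2;q^2)_oo. *)
Require Import Defs.
From mathcomp Require Import all_boot all_order all_algebra finmap.
From mathcomp Require Import all_classical all_reals all_analysis.
From mathcomp Require Import complex summability ring lra zify.

Set Implicit Arguments.
Unset Strict Implicit.
Unset Printing Implicit Defensive.

Import Order.TTheory GRing.Theory Num.Theory.
Import numFieldNormedType.Exports ComplexField.Normc.

Local Open Scope classical_set_scope.
Local Open Scope ring_scope.
Local Open Scope complex_scope.

(** * Convergence of complex sequences and infinite products, measured by the real modulus *)

Section ComplexLimits.
Variable R : realType.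
Local Notation C := (R[i] : numFieldType).
Implicit Types (x l : C) (u v : nat -> C).

Lemma normr_normc x : `|x| = (normc x)%:C.
Proof. by []. Qed.

Lemma normc_ge0 x : 0 <= normc x.
Proof. by case: x => a b; rewrite /= sqrtr_ge0. Qed.

Lemma normcX x n : normc (x ^+ n) = normc x ^+ n.
Proof. by elim: n => [|n IH]; rewrite ?expr0 ?normc1// !exprS normcM IH. Qed.

(** In the partial order on complex numbers a positive element has zero imaginary part, so testing
    real [e] loses nothing. *)
Lemma cvg_normcP (T : Type) (F : set_system T) {FF : Filter F} (f : T -> C) l :
  f @ F --> l <-> (forall e : R, 0 < e -> \forall t \near F, normc (l - f t) <= e).
Proof.
split=> [/cvgrPdist_le fl e e0|fl].
  have /fl : 0 < e%:C by rewrite ltcR.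
  by apply: filterS => t; rewrite normr_normc lecR.
apply/cvgrPdist_le => -[a b]; rewrite ltcE /= => /andP[/eqP-> a0].
have := fl _ a0; apply: filterS => t.
by rewrite normr_normc complexr0 lecR.
Qed.

Lemma normcD x y : normc (x + y) <= normc x + normc y.
Proof. exact: le_normcD. Qed.

Lemma normcB x y : normc (x - y) <= normc x + normc y.
Proof. by rewrite -(normcN y); exact: normcD. Qed.

Lemma normc_distC x y : normc (x - y) = normc (y - x).
Proof. by rewrite -(normcN (x - y)) opprB. Qed.

Lemma normc_sum (I : Type) (r : seq I) (P : pred I) (f : I -> C) :
  normc (\sum_(i <- r | P i) f i) <= \sum_(i <- r | P i) normc (f i).
Proof.
elim/big_ind2: _ => [|x a y b xa yb|//]; first by rewrite normc0.
by rewrite (le_trans (normcD _ _))// lerD.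
Qed.

Lemma Re_le_normc x : `|complex.Re x| <= normc x.
Proof. by have := normc_ge_Re x; rewrite normr_normc lecR. Qed.

Lemma Im_le_normc x : `|complex.Im x| <= normc x.
Proof. by case: x => a b /=; rewrite -sqrtr_sqr ler_sqrt ?lerDr ?addr_ge0 ?sqr_ge0. Qed.

Lemma cvgc_squeeze u l (d : nat -> R) :
  (forall n, normc (l - u n) <= d n) -> d @ \oo --> (0 : R) -> u @ \oo --> l.
Proof.
move=> ud /cvgrPdist_le d0; apply/cvg_normcP => e e0.
have := d0 _ e0; apply: filterS => n.
rewrite sub0r normrN => dn; apply: le_trans (ud n) _.
exact: le_trans (ler_norm _) dn.
Qed.

Lemma limc_dist_le u l x (b : R) :
  u @ \oo --> l -> (forall n, normc (x - u n) <= b) -> normc (x - l) <= b.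
Proof.
move=> /cvg_normcP ul xu; apply/ler_addgt0Pr => e /ul ule.
have [n une] := filter_ex ule.
rewrite -(subrKA (u n)) (le_trans (normcD _ _))// lerD ?xu//.
by rewrite normc_distC.
Qed.

Lemma cvgc_unique u l l' : u @ \oo --> l -> u @ \oo --> l' -> l = l'.
Proof. by move=> ul ul'; rewrite -(cvg_lim _ ul)// -(cvg_lim _ ul'). Qed.

Lemma cvgc_succ u l : (fun n => u n.+1) @ \oo --> l <-> u @ \oo --> l.
Proof. by rewrite -(cvg_shiftS u). Qed.

Lemma cvg_mul_exprn (k x : R) : 0 <= x < 1 -> (fun n => k * x ^+ n) @ \oo --> (0 : R).
Proof.
move=> /andP[x0 x1]; rewrite -(mulr0 k).
by apply: cvgM; [exact: cvg_cst|apply: cvg_expr; rewrite ger0_norm].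
Qed.

(** The increments form a series dominated by a geometric one, and [w] is its partial sums shifted
    by [w 0]. *)
Lemma cvg_geometric_increments (w : nat -> R) (c r : R) :
  0 <= r < 1 -> (forall n, `|w n.+1 - w n| <= c * r ^+ n) ->
  exists l : R, w @ \oo --> l.
Proof.
move=> /andP[r0 r1] wr.
have c0 : 0 <= c by rewrite (le_trans (normr_ge0 _) (le_trans (wr 0) _))// expr0 mulr1.
have cw : cvgn (series (fun k => w k.+1 - w k)).
  apply: normed_cvg; apply: (series_le_cvg _ _ wr) => [n|n|].
  - exact: normr_ge0.
  - by rewrite mulr_ge0 ?exprn_ge0.
  - by apply: is_cvg_geometric_series; rewrite ger0_norm.
have /cvg_ex[l wl] := cw.
exists (l + w 0%N).
have wE : w = (fun n => series (fun k => w k.+1 - w k) n + w 0%N).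
  by apply/funext => n; rewrite /series /= telescope_sumr// subrK.
rewrite [X in X @ _ --> _]wE.
by apply: cvgD => //; exact: cvg_cst.
Qed.

(** Real and imaginary parts inherit the increment bound, which reduces the claim to the real
    case. *)
Lemma cvgc_geometric_increments u (c r : R) :
  0 <= r < 1 -> (forall n, normc (u n.+1 - u n) <= c * r ^+ n) ->
  exists l, u @ \oo --> l.
Proof.
move=> r01 ur.
have [a ua] : exists a : R, (fun n => complex.Re (u n)) @ \oo --> a.
  apply: cvg_geometric_increments r01 _ => n; apply: le_trans (ur n).
  by apply: le_trans (Re_le_normc _); case: (u n) (u n.+1) => ? ? [].
have [b ub] : exists b : R, (fun n => complex.Im (u n)) @ \oo --> b.
  apply: cvg_geometric_increments r01 _ => n; apply: le_trans (ur n).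
  by apply: le_trans (Im_le_normc _); case: (u n) (u n.+1) => ? ? [].
exists (a +i* b).
apply: (cvgc_squeeze (d := fun n => `|a - complex.Re (u n)| + `|b - complex.Im (u n)|)) => [n|].
  have -> : (a +i* b : C) - u n
      = (a - complex.Re (u n))%:C + 'i%C * (b - complex.Im (u n))%:C.
    by rewrite [LHS]complexE; case: (u n).
  rewrite (le_trans (normcD _ _))// normcM /= !expr0n /= !addr0 add0r.
  by rewrite expr1n sqrtr1 mul1r !sqrtr_sqr.
rewrite -(addr0 0); apply: cvgD.
  have /cvgrPdist_le ua' := ua; apply/cvgrPdist_le => e /ua'.
  by apply: filterS => n; rewrite sub0r normrN normr_id.
have /cvgrPdist_le ub' := ub; apply/cvgrPdist_le => e /ub'.
by apply: filterS => n; rewrite sub0r normrN normr_id.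
Qed.

Lemma geometric_sum_le (r : R) n :
  0 <= r < 1 -> \sum_(0 <= k < n) r ^+ k <= (1 - r)^-1.
Proof.
move=> /andP[r0 r1]; have d0 : 0 < 1 - r by rewrite subr_gt0.
rewrite -[leRHS]mul1r ler_pdivlMr// mulrC -opprB mulNr big_mkord -subrX1 opprB.
by rewrite gerBl exprn_ge0.
Qed.

(** Each factor satisfies [1 + x <= expR x], and the exponents add up to at most a full geometric
    series. The bound is uniform in [n]. *)
Lemma normc_prod_le (a : nat -> C) (c r : R) n :
  0 <= r < 1 -> (forall k, normc (a k) <= c * r ^+ k) ->
  normc (\prod_(0 <= k < n) (1 + a k)) <= expR (c / (1 - r)).
Proof.
move=> r01 ar.
have c0 : 0 <= c by rewrite (le_trans (normc_ge0 _) (le_trans (ar 0) _))// expr0 mulr1.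
apply: (@le_trans _ _ (expR (\sum_(0 <= k < n) c * r ^+ k))); last first.
  by rewrite ler_expR -mulr_sumr ler_wpM2l// geometric_sum_le.
elim: n => [|n IH]; first by rewrite !big_nil normc1 expR0.
rewrite !big_nat_recr//= normcM expRD ler_pM ?normc_ge0//.
by rewrite (le_trans (normcD _ _))// normc1 (le_trans _ (expR_ge1Dx _))// lerD2l.
Qed.

(** Consecutive partial products differ by a bounded product times [a n], hence by a geometrically
    small amount. *)
Lemma cvg_prodc (a : nat -> C) (c r : R) :
  0 <= r < 1 -> (forall k, normc (a k) <= c * r ^+ k) ->
  exists l, (fun n => \prod_(0 <= k < n) (1 + a k)) @ \oo --> l.
Proof.
move=> r01 ar.
apply: (@cvgc_geometric_increments _ (expR (c / (1 - r)) * c) r) => // n.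
rewrite big_nat_recr//= mulrDr mulr1 addrC addKr normcM -mulrA.
by rewrite ler_pM ?normc_ge0// (normc_prod_le _ r01).
Qed.

End ComplexLimits.

(** * Convergence, nonvanishing and reciprocal bounds for q-Pochhammer products *)

Section QPochhammer.
Variable R : realType.
Local Notation C := (R[i] : numFieldType).
Implicit Types a q : C.

Lemma qpochS a q n : qpoch a q n.+1 = qpoch a q n * (1 - a * q ^+ n).
Proof. by rewrite /qpoch big_nat_recr. Qed.

Lemma cvg_qpoch a q : normc q < 1 -> qpoch a q @ \oo --> qpoch_infty a q.
Proof.
move=> q1.
have [l al] : exists l : C, (fun n => \prod_(0 <= k < n) (1 + - (a * q ^+ k))) @ \oo --> l.
  apply: (@cvg_prodc _ _ (normc a) (normc q)) => [|k].
    by rewrite normc_ge0.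
  by rewrite normcN normcM normcX.
by rewrite /qpoch_infty; apply: (cvgP _ al).
Qed.

Lemma normc_1sub_ge a q k : normc a < 1 -> normc q < 1 ->
  1 - normc a <= normc (1 - a * q ^+ k).
Proof.
move=> a1 q1; rewrite lerBlDr -[leLHS](@normc1 R) -[X in normc X <= _](subrK (a * q ^+ k)).
rewrite (le_trans (normcD _ _))// lerD2l normcM normcX ler_piMr ?normc_ge0//.
by rewrite exprn_ile1 ?normc_ge0// ltW.
Qed.

Lemma qpoch_factor_neq0 a q k : normc a < 1 -> normc q < 1 -> 1 - a * q ^+ k != 0.
Proof.
move=> a1 q1; apply/eqP => e; have := @normc_1sub_ge a q k a1 q1.
by rewrite e normc0 leNgt subr_gt0 a1.
Qed.

Lemma qpoch_neq0 a q n : normc a < 1 -> normc q < 1 -> qpoch a q n != 0.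
Proof.
move=> a1 q1; elim: n => [|n IH]; first by rewrite /qpoch big_nil oner_eq0.
by rewrite qpochS mulf_neq0// qpoch_factor_neq0.
Qed.

Section Inverse.
Variables a q : C.
Hypotheses (a1 : normc a < 1) (q1 : normc q < 1).

(** Chosen so that [1 + b k] inverts [1 - a * q ^+ k]: the reciprocal product then falls under the
    same bounds as the product itself. *)
Let b k := a * q ^+ k / (1 - a * q ^+ k).

Let qpochV n : (qpoch a q n)^-1 = \prod_(0 <= k < n) (1 + b k).
Proof.
rewrite /qpoch -prodfV; apply: eq_bigr => k _.
have := qpoch_factor_neq0 k a1 q1; rewrite /b => h.
by apply: (mulfI h); rewrite divff// mulrDr mulr1 mulrCA divff// mulr1 subrK.
Qed.

Let normc_b k : normc (b k) <= normc a / (1 - normc a) * normc q ^+ k.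
Proof.
rewrite /b normcM normcV normcM normcX mulrAC ler_wpM2r ?exprn_ge0 ?normc_ge0//.
rewrite ler_wpM2l ?normc_ge0// lef_pV2 ?posrE ?subr_gt0// ?normc_1sub_ge//.
by rewrite (lt_le_trans _ (normc_1sub_ge k a1 q1))// subr_gt0.
Qed.

Lemma normc_qpochV_le : exists2 c : R, 0 <= c & forall n, normc (qpoch a q n)^-1 <= c.
Proof.
exists (expR (normc a / (1 - normc a) / (1 - normc q))) => [|n]; first exact: expR_ge0.
by rewrite qpochV; apply: normc_prod_le normc_b; rewrite normc_ge0.
Qed.

(** The reciprocal products converge too, and product times reciprocal is constantly 1, so a zero
    limit would give [0 = 1]. *)
Lemma qpoch_infty_neq0 : qpoch_infty a q != 0.
Proof.
have [l bl] := @cvg_prodc _ b _ (normc q) (introT andP (conj (normc_ge0 q) q1)) normc_b.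
have al : (fun n => qpoch a q n * \prod_(0 <= k < n) (1 + b k)) @ \oo --> qpoch_infty a q * l.
  by apply: cvgM bl; exact: cvg_qpoch.
have e1 : (fun n => qpoch a q n * \prod_(0 <= k < n) (1 + b k)) = cst 1.
  by apply/funext => n; rewrite -qpochV divff// qpoch_neq0.
rewrite e1 in al; apply/eqP => a0; rewrite a0 mul0r in al.
have h01 : (0 : C) = 1 by apply: cvgc_unique al (cvg_cst (1 : C)).
by move/eqP: h01; rewrite eq_sym oner_eq0.
Qed.
End Inverse.

End QPochhammer.

(** * Double series dominated by a product of geometric series *)

Section DominatedDoubleSums.
Variable R : realType.
Local Notation C := (R[i] : numFieldType).
Variables (v : nat -> nat -> C) (c r : R).
Hypotheses (r01 : 0 <= r < 1) (vr : forall i j, normc (v i j) <= c * r ^+ i * r ^+ j).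

Let r0 : 0 <= r. Proof. by case/andP: r01. Qed.
Let r1 : r < 1. Proof. by case/andP: r01. Qed.
Let d0 : 0 < 1 - r. Proof. by rewrite subr_gt0. Qed.
Let c0 : 0 <= c.
Proof. by rewrite (le_trans (normc_ge0 _) (le_trans (vr 0 0) _))// !expr0 !mulr1. Qed.

(** Cutting the inner sum at [n] costs at most a constant times [r ^+ n * r ^+ j]; summed over [j]
    this still tends to 0, so one cutoff serves both indices. *)
Lemma dominated_iterated_sum (V : nat -> C) (L : C) :
  (forall j, (fun n => \sum_(0 <= i < n) v i j) @ \oo --> V j) ->
  (fun n => \sum_(0 <= j < n) V j) @ \oo --> L ->
  (fun n => \sum_(0 <= i < n) \sum_(0 <= j < n) v i j) @ \oo --> L.
Proof.
move=> vV VL.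
have tail n j : normc (\sum_(0 <= i < n) v i j - V j) <= c / (1 - r) * r ^+ n * r ^+ j.
  have vVn : (fun m => \sum_(0 <= i < m + n) v i j) @ \oo --> V j.
    by have := vV j; rewrite -(cvg_shiftn n).
  apply: limc_dist_le vVn _ => m.
  rewrite [X in _ - X](@big_cat_nat _ _ _ n)//= ?leq_addl//.
  rewrite opprD addNKr normcN (le_trans (normc_sum _ _ _))//.
  apply: (@le_trans _ _ (\sum_(n <= i < m + n) c * r ^+ i * r ^+ j)).
    by apply: ler_sum => i _; exact: vr.
  rewrite -mulr_suml ler_wpM2r ?exprn_ge0// -mulr_sumr -mulrA ler_wpM2l//.
  rewrite -{1}[n]add0n big_addn addnK.
  under eq_bigr do rewrite exprD.
  by rewrite -mulr_suml ler_wpM2r ?exprn_ge0// geometric_sum_le.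
(* The first term is the error of the outer sum, the second the total of the inner errors; each
   index contributes one factor [(1 - r)^-1]. *)
apply: (cvgc_squeeze (d := fun n => normc (L - \sum_(0 <= j < n) V j)
    + c / (1 - r) / (1 - r) * r ^+ n)) => [n|]; last first.
  rewrite -[X in _ --> X](addr0 (0 : R)); apply: cvgD; last exact: cvg_mul_exprn.
  apply/cvgrPdist_le => e e0; have /cvg_normcP VL' := VL.
  have := VL' _ e0; apply: filterS => n.
  by rewrite sub0r normrN ger0_norm// normc_ge0.
rewrite -(subrKA (\sum_(0 <= j < n) V j)) (le_trans (normcD _ _))// lerD2l.
rewrite exchange_big/= -sumrB (le_trans (normc_sum _ _ _))//.
apply: (@le_trans _ _ (\sum_(0 <= j < n) c / (1 - r) * r ^+ n * r ^+ j)).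
  by apply: ler_sum => j _; rewrite normc_distC tail.
rewrite -mulr_sumr [leRHS]mulrAC ler_wpM2l ?geometric_sum_le//.
by rewrite mulr_ge0 ?exprn_ge0// divr_ge0// ltW.
Qed.

Let square n := [seq (i, j) | i <- index_iota 0 n, j <- index_iota 0 n].

Let mem_square n x : (x \in square n) = (x.1 < n)%N && (x.2 < n)%N.
Proof.
apply/allpairsP/andP => [[[i j]] /= []|[x1 x2]].
  by rewrite !mem_index_iota => i1 j1 ->.
by exists x; rewrite !mem_index_iota; case: x x1 x2.
Qed.

Let uniq_square n : uniq (square n).
Proof. by rewrite allpairs_uniq ?iota_uniq// => -[? ?] [? ?]. Qed.

Let G (x : nat * nat) := c * r ^+ x.1 * r ^+ x.2.

Let G0 x : 0 <= G x. Proof. by rewrite /G !mulr_ge0 ?exprn_ge0. Qed.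

Let sum_square n : \sum_(x <- square n) G x = c / (1 - r) ^+ 2 * (1 - r ^+ n) ^+ 2.
Proof.
have gE : \sum_(0 <= k < n) r ^+ k = (1 - r ^+ n) / (1 - r).
  by rewrite -[1 - r ^+ n]opprB subrX1 big_mkord -mulNr opprB mulrC mulKf// gt_eqF.
rewrite big_allpairs /G /=.
under eq_bigr do rewrite -mulr_sumr gE.
by rewrite -mulr_suml -mulr_sumr gE; field; rewrite gt_eqF.
Qed.

Let sum_sub (A : nmodType) (F : nat * nat -> A) (s t : seq (nat * nat)) :
  uniq s -> uniq t -> {subset s <= t} ->
  \sum_(x <- t | x \in s) F x = \sum_(x <- s) F x.
Proof.
move=> us ut st; rewrite -big_filter; apply: perm_big.
apply: uniq_perm; rewrite ?filter_uniq// => x.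
by rewrite mem_filter andb_idr//; exact: st.
Qed.

(** Every finite set of pairs lies in some square, where the sum of [G] is known in closed form. *)
Let sum_G_le (s : seq (nat * nat)) : uniq s -> \sum_(x <- s) G x <= c / (1 - r) ^+ 2.
Proof.
move=> us.
pose N := \max_(x <- s) (maxn x.1 x.2).+1.
have sN : {subset s <= square N}.
  move=> x xs; rewrite mem_square -gtn_max.
  by rewrite /N (big_rem x)//= leq_maxl.
rewrite -(sum_sub G us (uniq_square N) sN).
apply: (@le_trans _ _ (\sum_(x <- square N) G x)).
  by rewrite [leRHS](bigID (mem s))/= lerDl sumr_ge0.
rewrite sum_square ler_piMr ?divr_ge0 ?sqr_ge0// exprn_ile1 ?subr_ge0 ?gerBl ?exprn_ge0//.
by rewrite exprn_ile1// ltW.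
Qed.

(** If a finite set contains a large square, its part outside the square weighs at most the bound of
    [sum_G_le] minus the exact square sum, which is small. *)
Lemma has_double_sum_square (L : C) :
  (fun n => \sum_(0 <= i < n) \sum_(0 <= j < n) v i j) @ \oo --> L ->
  has_double_sum v L.
Proof.
move=> vL; have tF := @totally_filter (nat * nat)%type.
apply/cvg_normcP => e e0.
have e20 : 0 < e / 2 by rewrite divr_gt0.
have /cvg_normcP /(_ _ e20) vLe := vL.
(* The factor 2 comes from [1 - (1 - x) ^+ 2 <= 2 * x] at [x = r ^+ n]. *)
have /cvgrPdist_le /(_ _ e20) re := cvg_mul_exprn (2 * c / (1 - r) ^+ 2) r01.
have [n [/= vn rn]] := filter_ex (filterI vLe re).
exists [fset x | x in square n]%fset => // B /= nB.
rewrite /partial_sum -(big_seq_fsetE _ _ predT (fun x => v x.1 x.2)) /=.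
have sub : {subset square n <= B}.
  by move=> x xn; apply: (fsubsetP nB); rewrite inE.
rewrite (bigID (mem (square n)))/= sum_sub ?uniq_square ?fset_uniq// big_allpairs/= opprD addrA.
rewrite [leRHS]splitr (le_trans (normcB _ _))// lerD//.
rewrite (le_trans (normc_sum _ _ _))//.
apply: (@le_trans _ _ (\sum_(x <- B | x \notin square n) G x)).
  by apply: ler_sum => x _; exact: vr.
have := sum_G_le (fset_uniq B).
rewrite (bigID (mem (square n)))/= sum_sub ?uniq_square ?fset_uniq// sum_square -lerBrDl => h.
apply: le_trans h (le_trans _ rn).
rewrite sub0r normrN ger0_norm; last first.
  by rewrite !mulr_ge0 ?exprn_ge0// invr_ge0 sqr_ge0.
rewrite -[in leRHS](mulrA 2); set K := c / _.
have : 0 <= K * (r ^+ n) ^+ 2 by rewrite mulr_ge0 ?sqr_ge0// divr_ge0 ?sqr_ge0.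
by lra.
Qed.
End DominatedDoubleSums.

(** * Euler's expansion and the inner sum over [i] *)

Section GaussianSums.
Variable R : realType.
Local Notation C := (R[i] : numFieldType).
Variable s : C.
Hypotheses (s0 : 0 < normc s) (s1 : normc s < 1).
Let q : C := s ^+ 2.
Let p n : C := qpoch q q n.

Let r := normc s.
Let r01 : 0 <= r < 1. Proof. by rewrite normc_ge0. Qed.
Let r0 : 0 <= r. Proof. exact: normc_ge0. Qed.
Let r1 : r <= 1. Proof. exact: ltW. Qed.
Let sn0 : s != 0.
Proof. by apply: contraTneq s0 => ->; rewrite normc0 ltxx. Qed.
Let q1 : normc q < 1.
Proof. by rewrite normcX exprn_ilt1. Qed.
Let pn0 n : p n != 0. Proof. exact: qpoch_neq0. Qed.
Let pS n : p n.+1 = p n * (1 - q ^+ n.+1). Proof. by rewrite /p qpochS -exprS. Qed.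

Let le_rX m n k : (m <= n)%N -> k = normc (s ^+ n) -> k <= r ^+ m.
Proof. by move=> mn ->; rewrite normcX ler_wiXn2l. Qed.

(** Euler's series for [(-s q^m; q)_oo], whose general term is
    [q^(i(i-1)/2) (s q^m)^i / (q;q)_i]. *)
Let euler_term m i : C := s ^+ (i ^ 2 + 2 * m * i) / p i.
Let euler_sum n m : C := \sum_(0 <= i < n) euler_term m i.

(** An exact truncated form of [(x;q)_oo = (1 - x) (xq;q)_oo]. Splitting 1 as
    [q ^+ i + (1 - q ^+ i)] in each numerator raises [m] in the first part and cancels the last
    factor of [p i] in the second, lowering [i]. *)
Let euler_sumS n m : euler_sum n.+1 m = euler_sum n.+1 m.+1 + s ^+ (2 * m).+1 * euler_sum n m.+1.
Proof.
elim: n => [|n IH].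
  by rewrite /euler_sum !big_nat1 big_nil mulr0 addr0 /euler_term !muln0.
rewrite /euler_sum big_nat_recr//= -/(euler_sum _ _) IH.
rewrite [in RHS]big_nat_recr//= [X in _ = _ + _ * X]big_nat_recr//= -!/(euler_sum _ _).
suff : euler_term m n.+1 = euler_term m.+1 n.+1 + s ^+ (2 * m).+1 * euler_term m.+1 n.
  by move=> ->; ring.
rewrite /euler_term !pS.
have -> : (n.+1 ^ 2 + 2 * m.+1 * n.+1 = (n.+1 ^ 2 + 2 * m * n.+1) + 2 * n.+1)%N by lia.
rewrite [s ^+ (_ + 2 * n.+1)%N]exprD [s ^+ (2 * n.+1)%N]exprM -/q.
have -> : s ^+ (n.+1 ^ 2 + 2 * m * n.+1) = s ^+ (2 * m).+1 * s ^+ (n ^ 2 + 2 * m.+1 * n).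
  by rewrite -exprD; congr (_ ^+ _); lia.
have := qpoch_factor_neq0 n q1 q1; rewrite -exprS => h.
by field; rewrite h pn0.
Qed.

Let euler_sum_cvg : exists E : nat -> C, forall m, euler_sum ^~ m @ \oo --> E m.
Proof.
suff cv m : exists l : C, euler_sum ^~ m @ \oo --> l.
  by have [E eE] := choice cv; exists E.
have [c c0 pc] := normc_qpochV_le q1 q1.
(* The exponent [n ^ 2 + 2 * m * n] is at least [n], and [c] bounds the reciprocals of [p]. *)
apply: (@cvgc_geometric_increments _ _ c r) => // n.
have -> : euler_sum n.+1 m - euler_sum n m = euler_term m n.
  by rewrite /euler_sum big_nat_recr//= [LHS]addrC addKr.
rewrite normcM mulrC.
rewrite ler_pM ?normc_ge0//; apply: le_rX (erefl _); nia.
Qed.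

(** The term at index 0 is 1, and the term at [i.+1] has exponent at least [m + i]. Uniformity in
    [n] lets the bound pass to the limits. *)
Let normc_euler_sum_sub1 : exists c : R, forall n m, normc (1 - euler_sum n.+1 m) <= c * r ^+ m.
Proof.
have [c c0 pc] := normc_qpochV_le q1 q1.
exists (c / (1 - r)) => n m.
rewrite /euler_sum big_nat_recl//= /euler_term muln0 expr0 /p {1}/qpoch.
rewrite big_nil divr1 opprD addNKr normcN.
apply: (le_trans (normc_sum _ _ _)).
apply: (@le_trans _ _ (\sum_(0 <= i < n) c * r ^+ m * r ^+ i)).
  apply: ler_sum => i _; rewrite normcM mulrC -mulrA -exprD.
  rewrite ler_pM ?normc_ge0//; apply: le_rX (erefl _); nia.
rewrite -mulr_sumr [leRHS]mulrAC ler_wpM2l ?geometric_sum_le//.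
by rewrite mulr_ge0 ?exprn_ge0.
Qed.

Let one_add_sX m : 1 - (- s) * q ^+ m = 1 + s ^+ (2 * m).+1.
Proof. by rewrite mulNr opprK exprS exprM. Qed.

(* Euler's expansion of [(x; q)_oo] at [x = - s]: the limits [E m] satisfy
   [E m = (1 + s ^+ (2 * m).+1) * E m.+1] and tend to [1]. *)
Let euler_sum0_cvg : euler_sum ^~ 0%N @ \oo --> qpoch_infty (- s) q.
Proof.
have [E eE] := euler_sum_cvg.
have ES m : E m = (1 + s ^+ (2 * m).+1) * E m.+1.
  apply: cvgc_unique (iffRL (@cvgc_succ _ (euler_sum ^~ m) _) (eE m)) _.
  have -> : (fun n => euler_sum n.+1 m)
      = (fun n => euler_sum n.+1 m.+1 + s ^+ (2 * m).+1 * euler_sum n m.+1).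
    by apply/funext => n; exact: euler_sumS.
  rewrite mulrDl mul1r.
  apply: cvgD; first exact: iffRL (@cvgc_succ _ (euler_sum ^~ m.+1) _) (eE m.+1).
  by apply: cvgM; [exact: cvg_cst|exact: eE].
have E0 m : E 0%N = qpoch (- s) q m * E m.
  elim: m => [|m IH]; first by rewrite /qpoch big_nil mul1r.
  by rewrite qpochS one_add_sX -mulrA -ES.
have E1 : E @ \oo --> (1 : C).
  have [c ec] := normc_euler_sum_sub1.
  apply: (cvgc_squeeze (d := fun m => c * r ^+ m)) => [m|]; last exact: cvg_mul_exprn.
  exact: limc_dist_le (iffRL (@cvgc_succ _ (euler_sum ^~ m) _) (eE m)) _.
have : (fun m => qpoch (- s) q m * E m) @ \oo --> qpoch_infty (- s) q * 1.
  by apply: cvgM; [exact: cvg_qpoch|exact: E1].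
rewrite mulr1 -(funext E0) => /(cvgc_unique (cvg_cst (E 0%N))) <-.
exact: eE.
Qed.

(* Up to the factor [s ^+ (j ^ 2)], this is [euler_term] at [m = - j]. *)
Let gterm j i : C := s ^ ((i%:Z - j%:Z) ^+ 2) / p i.
Let gsum n j : C := \sum_(0 <= i < n) gterm j i.

(** The same splitting of 1: the part [1 - q ^+ i] lowers both indices and keeps [i - j], while the
    part [q ^+ i] completes the square to [(i - j) ^+ 2] for the smaller [j]. *)
Let gsumS n j : gsum n.+1 j.+1 = gsum n j + s ^+ (2 * j).+1 * gsum n.+1 j.
Proof.
elim: n => [|n IH].
  rewrite /gsum !big_nat1 big_nil add0r /gterm mulrA; congr (_ / _).
  by rewrite (exprnP s) -expfzDr//; congr (_ ^ _); lia.
rewrite /gsum big_nat_recr//= -/(gsum _ _) IH.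
rewrite [X in _ = X + _]big_nat_recr//= [X in _ = _ + _ * X]big_nat_recr//= -!/(gsum _ _).
suff : gterm j.+1 n.+1 = gterm j n + s ^+ (2 * j).+1 * gterm j n.+1.
  by move=> ->; ring.
rewrite /gterm !pS.
have -> : (n.+1%:Z - j.+1%:Z) ^+ 2 = (n%:Z - j%:Z) ^+ 2 by congr (_ ^+ 2); lia.
have -> : s ^+ (2 * j).+1 * (s ^ ((n.+1%:Z - j%:Z) ^+ 2) / (p n * (1 - q ^+ n.+1)))
    = s ^ ((n%:Z - j%:Z) ^+ 2) * q ^+ n.+1 / (p n * (1 - q ^+ n.+1)).
  rewrite mulrA; congr (_ / _).
  by rewrite /q -exprM !(exprnP s) -!expfzDr//; congr (_ ^ _); lia.
have := qpoch_factor_neq0 n q1 q1; rewrite -exprS => h.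
by field; rewrite h pn0.
Qed.

(** Induction on [j] from Euler's case [j = 0]: in the limit [gsumS] multiplies by
    [1 + s ^+ (2 * j).+1], the next factor of [qpoch (- s) q]. *)
Lemma gaussian_sum_cvg j :
  (fun n => \sum_(0 <= i < n) s ^ ((i%:Z - j%:Z) ^+ 2) / qpoch q q i) @ \oo -->
  qpoch_infty (- s) q * qpoch (- s) q j.
Proof.
change (gsum ^~ j @ \oo --> qpoch_infty (- s) q * qpoch (- s) q j).
elim: j => [|j IH].
  rewrite /qpoch big_nil mulr1 -/(qpoch _ _).
  suff -> : gsum ^~ 0%N = euler_sum ^~ 0%N by exact: euler_sum0_cvg.
  apply/funext => n; apply: eq_bigr => i _; congr (_ / _).
  by rewrite (exprnP s); congr (_ ^ _); lia.
apply: (iffLR (@cvgc_succ _ (gsum ^~ j.+1) _)).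
have -> : (fun n => gsum n.+1 j.+1) = (fun n => gsum n j + s ^+ (2 * j).+1 * gsum n.+1 j).
  by apply/funext => n; exact: gsumS.
rewrite qpochS one_add_sX mulrA mulrDr mulr1 [X in _ + X]mulrC.
apply: cvgD; first exact: IH.
apply: cvgM; first exact: cvg_cst.
exact: (iffRL (@cvgc_succ _ (gsum ^~ j) _)).
Qed.
End GaussianSums.

(** * The outer sum, infinite product identities and the double sum *)

Section TheDoubleSum.
Variable R : realType.
Local Notation C := (R[i] : numFieldType).

(** The sum telescopes because [(1 - q ^+ n.+1) + (1 - a) * q ^+ n.+1 = 1 - a * q ^+ n.+1]. *)
Lemma qpoch_sum (a q : C) n : normc q < 1 ->
  (1 - a) * \sum_(0 <= j < n.+1) qpoch a q j * (q ^+ j / qpoch q q j) =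
  qpoch a q n.+1 / qpoch q q n.
Proof.
move=> q1; elim: n => [|n IH].
  by rewrite big_nat1 /qpoch !big_nil big_nat1 !expr0 divr1 mul1r !mulr1 divr1.
rewrite big_nat_recr//= mulrDr IH qpochS [qpoch q q n.+1]qpochS -exprS.
have := qpoch_factor_neq0 n q1 q1; rewrite -exprS => h.
by have := qpoch_neq0 n q1 q1; rewrite (qpochS a q n.+1) (qpochS a q n) => h'; field; rewrite h h'.
Qed.

(** The first [2 * n] factors separate into odd and even powers of [q]; the limit is taken along
    this subsequence. *)
Lemma qpoch_infty_evenodd (q : C) : normc q < 1 ->
  qpoch_infty q q = qpoch_infty q (q ^+ 2) * qpoch_infty (q ^+ 2) (q ^+ 2).
Proof.
move=> q1; have q21 : normc (q ^+ 2) < 1 by rewrite normcX exprn_ilt1// normc_ge0.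
have fin n : qpoch q q (2 * n) = qpoch q (q ^+ 2) n * qpoch (q ^+ 2) (q ^+ 2) n.
  elim: n => [|n IH]; first by rewrite /qpoch !big_nil mulr1.
  by rewrite mulnS !qpochS IH -!exprM -!exprS -exprD; ring.
apply: (@cvgc_unique _ (fun n => qpoch q q (2 * n))).
  by apply: (cvg_comp (muln 2) (qpoch q q)); [exact: cvg_mulnl|exact: cvg_qpoch].
rewrite (funext fin).
by apply: cvgM; apply: cvg_qpoch.
Qed.

Lemma qpoch_infty_mulN (a q : C) : normc q < 1 ->
  qpoch_infty (- a) q * qpoch_infty a q = qpoch_infty (a ^+ 2) (q ^+ 2).
Proof.
move=> q1; have q21 : normc (q ^+ 2) < 1 by rewrite normcX exprn_ilt1// normc_ge0.
have fin n : qpoch (- a) q n * qpoch a q n = qpoch (a ^+ 2) (q ^+ 2) n.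
  rewrite /qpoch -big_split; apply: eq_bigr => k _ /=.
  by rewrite exprAC; ring.
apply: (@cvgc_unique _ (fun n => qpoch (- a) q n * qpoch a q n)).
  by apply: cvgM; apply: cvg_qpoch.
by rewrite (funext fin); exact: cvg_qpoch.
Qed.

(** Turns the integer exponent into a natural one: the inequalities, [k >= |i - j|], serve the
    domination, and the parity serves the sign [(-1) ^+ (i + j)]. *)
Lemma sqr_int_nat (i j : nat) :
  exists k : nat, [/\ (i%:Z - j%:Z) ^+ 2 = k%:Z, (i <= k + j)%N, (j <= k + i)%N
    & odd k = odd (i + j)].
Proof.
wlog ij : i j / (i <= j)%N.
  move=> sqr_le; have [/sqr_le//|/ltnW/sqr_le[k [ek ik jk ok]]] := leqP i j.
  by exists k; split=> //; rewrite ?[(i + j)%N]addnC// -opprB sqrrN.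
have [d ->] : exists d, j = (i + d)%N by exists (j - i)%N; rewrite subnKC.
exists (d ^ 2)%N; split; [by lia|by lia|by nia|].
by rewrite oddX /= !oddD addbA addbb.
Qed.

Lemma gaussian_double_sum (s : C) : 0 < normc s -> normc s < 1 ->
  has_double_sum
    (fun i j : nat => s ^ ((i%:Z - j%:Z) ^+ 2) * ((s ^+ 2) ^+ j + s ^+ (2 * i + 1))
       / (qpoch (s ^+ 2) (s ^+ 2) i * qpoch (s ^+ 2) (s ^+ 2) j))
    (qpoch_infty (- s) (s ^+ 2) ^+ 2 / qpoch_infty (s ^+ 2) (s ^+ 2)).
Proof.
move=> s0 s1; set q := s ^+ 2.
have q1 : normc q < 1 by rewrite normcX exprn_ilt1// ltW.
have s01 : 0 <= normc s < 1 by rewrite ltW.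
have Ns1 : normc (- s) < 1 by rewrite normcN.
pose P : C := qpoch_infty (- s) q.
pose Q : C := qpoch_infty q q.
have Q0 : Q != 0 by exact: qpoch_infty_neq0.
have one_s0 : 1 + s != 0.
  by have := qpoch_factor_neq0 0 Ns1 q1; rewrite expr0 mulr1 opprK.
pose v i j : C := s ^ ((i%:Z - j%:Z) ^+ 2) / qpoch q q i * (q ^+ j / qpoch q q j).
have [c c0 qc] := normc_qpochV_le q1 q1.
have [K vr] : exists K, forall i j, normc (v i j) <= K * normc s ^+ i * normc s ^+ j.
  exists (c ^+ 2) => i j.
  rewrite /v; have [k [-> ij ji _]] := sqr_int_nat i j.
  rewrite -exprnP [X in normc X](_ : _ = s ^+ (k + 2 * j) * ((qpoch q q i)^-1 * (qpoch q q j)^-1)).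
    rewrite !normcM normcX -mulrA -exprD mulrC.
    rewrite ler_pM ?mulr_ge0 ?exprn_ge0 ?normc_ge0//.
      by rewrite expr2 ler_pM ?normc_ge0.
    by rewrite ler_wiXn2l ?normc_ge0 1?ltW//; lia.
  by rewrite exprD exprM -/q; ring.
have v_square : (fun n => \sum_(0 <= i < n) \sum_(0 <= j < n) v i j) @ \oo -->
    P * (P / (Q * (1 + s))).
  apply: (dominated_iterated_sum s01 vr
    (V := fun j => P * qpoch (- s) q j * (q ^+ j / qpoch q q j))).
    move=> j.
    have -> : (fun n => \sum_(0 <= i < n) v i j) = (fun n =>
        (\sum_(0 <= i < n) s ^ ((i%:Z - j%:Z) ^+ 2) / qpoch q q i) * (q ^+ j / qpoch q q j)).
      by apply/funext => n; rewrite mulr_suml.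
    by apply: cvgM; [exact: gaussian_sum_cvg|exact: cvg_cst].
  (* [qpoch_sum] has [n.+1] terms, hence the shift; its factor [1 - a] is [1 + s] at [a = - s]. *)
  apply/(iffLR (@cvgc_succ _ _ _)).
  have -> : (fun n => \sum_(0 <= j < n.+1) P * qpoch (- s) q j * (q ^+ j / qpoch q q j))
      = (fun n => P * (qpoch (- s) q n.+1 * ((qpoch q q n)^-1 * (1 + s)^-1))).
    apply/funext => n; under eq_bigr do rewrite -mulrA.
    rewrite -mulr_sumr; congr (_ * _); apply: (mulfI one_s0).
    rewrite -[X in (1 + X) * _ = _]opprK qpoch_sum//.
    by field; rewrite one_s0 qpoch_neq0.
  apply: cvgM; first exact: cvg_cst.
  apply: cvgM; first exact: (iffRL (@cvgc_succ _ (qpoch (- s) q) _) (@cvg_qpoch _ _ _ q1)).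
  rewrite invfM; apply: cvgM; last exact: cvg_cst.
  by apply: cvgV => //; exact: cvg_qpoch.
have -> : (fun i j : nat => s ^ ((i%:Z - j%:Z) ^+ 2) * (q ^+ j + s ^+ (2 * i + 1))
      / (qpoch q q i * qpoch q q j)) = (fun i j => v i j + s * v j i).
  apply/funext => i; apply/funext => j; rewrite /v -[j%:Z - _]opprB sqrrN.
  rewrite addn1 (exprS s) (exprM s) -/q.
  by field; rewrite !qpoch_neq0.
apply: (@has_double_sum_square _ _ (2 * K) (normc s) s01) => [i j|].
  rewrite (le_trans (normcD _ _))// -!mulrA mulrDl mul1r lerD//.
    by rewrite mulrA vr.
  rewrite normcM -[leRHS]mul1r ler_pM ?normc_ge0//; first exact: ltW.
  by rewrite [normc s ^+ i * _]mulrC mulrA vr.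
have -> : P ^+ 2 / Q = P * (P / (Q * (1 + s))) + s * (P * (P / (Q * (1 + s)))).
  by field; rewrite one_s0 Q0.
(* Square truncations are symmetric in the two indices, so the transposed terms have the same
   partial sums as [v]. *)
have -> : (fun n => \sum_(0 <= i < n) \sum_(0 <= j < n) (v i j + s * v j i)) =
    (fun n => \sum_(0 <= i < n) \sum_(0 <= j < n) v i j
      + s * \sum_(0 <= i < n) \sum_(0 <= j < n) v i j).
  apply/funext => n; under eq_bigr do rewrite big_split/= -mulr_sumr.
  by rewrite big_split/= -mulr_sumr; congr (_ + _ * _); exact: exchange_big.
apply: cvgD; first exact: v_square.
by apply: cvgM; [exact: cvg_cst|exact: v_square].
Qed.

End TheDoubleSum.

(* s is the chosen square root q^{1/2}, so q^{m/2} is s ^ m for m : int. *)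
Theorem theorem3p3 (R : realType) (q s : R[i])
    (hq0 : 0 < `|q|) (hq1 : `|q| < 1) (hs : s ^+ 2 = q) :
  has_double_sum
    (fun i j : nat =>
       (-1) ^+ (i + j) * s ^ ((i%:Z - j%:Z) ^+ 2) * (q ^+ j - s ^+ (2 * i + 1))
         / (qpoch q q i * qpoch q q j))
    (qpoch_infty s q ^+ 2 / qpoch_infty q q)
  /\
  has_double_sum
    (fun i j : nat =>
       s ^ ((i%:Z - j%:Z) ^+ 2) * (q ^+ j + s ^+ (2 * i + 1))
         / (qpoch q q i * qpoch q q j))
    (qpoch_infty q (q ^+ 2)
       / (qpoch_infty (q ^+ 2) (q ^+ 2) * qpoch_infty s q ^+ 2)).
Proof.
rewrite normr_normc ltcR -hs normcX in hq0.
rewrite normr_normc ltcR -hs normcX in hq1.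
have s0 : 0 < normc s.
  rewrite lt_neqAle normc_ge0 andbT eq_sym.
  by move: hq0; rewrite lt0r sqrf_eq0 => /andP[].
have s1 : normc s < 1 by move: hq1; rewrite expr_lt1// normc_ge0.
have q1 : normc q < 1 by rewrite -hs normcX.
have q21 : normc (q ^+ 2) < 1 by rewrite normcX exprn_ilt1// normc_ge0.
split.
  (* At [- s] the even power [q] is unchanged, the Gaussian factor gains [(-1) ^+ (i + j)] by
     parity, and [s ^+ (2 * i + 1)] changes sign. *)
  have := @gaussian_double_sum R (- s); rewrite normcN sqrrN opprK hs => /(_ s0 s1).
  congr (has_double_sum _ _); apply/funext => i; apply/funext => j.
  have [k [ek _ _ ok]] := sqr_int_nat i j.
  rewrite ek -!exprnP ![(- s) ^+ _]exprNn.
  have -> : (-1) ^+ k = (-1) ^+ (i + j) :> R[i].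
    by rewrite -signr_odd ok signr_odd.
  rewrite [(-1) ^+ (2 * i + 1)]exprD exprM sqrrN expr1n.
  by rewrite expr1n expr1 mul1r mulN1r.
have := gaussian_double_sum s0 s1; rewrite hs.
congr (has_double_sum _ _).
have B0 : qpoch_infty s q != 0 by exact: qpoch_infty_neq0.
have E0 : qpoch_infty (q ^+ 2) (q ^+ 2) != 0 by exact: qpoch_infty_neq0.
have D0 : qpoch_infty q (q ^+ 2) != 0 by exact: qpoch_infty_neq0.
rewrite (qpoch_infty_evenodd q1).
have := qpoch_infty_mulN s q1; rewrite hs => AB.
(* Here [(q;q^2)_oo] becomes [(-s;q)_oo (s;q)_oo], and its nonvanishing passes to the first
   factor. *)
rewrite -AB in D0 *; rewrite mulf_eq0 negb_or in D0; case/andP: D0 => A0 _.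
have cancel (F : fieldType) (x y z : F) : x != 0 -> y != 0 -> z != 0 ->
    x ^+ 2 / (x * y * z) = x * y / (z * y ^+ 2).
  by move=> x0 y0 z0; field; rewrite x0 y0 z0.
exact: cancel.
Qed.
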